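(* If $\iota\colon\mathfrak A\hookrightarrow\mathfrak C$ and $\iota'\colon\mathfrak A\hookrightarrow\mathfrak C'$ are compatible completions of the representable $\{-,\triangleright\}$-algebra $\mathfrak A$, then there is a unique isomorphism $\theta\colon\mathfrak C\to\mathfrak C'$ satisfying the condition $\theta\circ\iota=\iota'$.
   Context: A partial function from $X$ to $Y$ is a set $f\subseteq X\times Y$ such that $(x,y),(x,z)\in f$ implies $y=z$; $\mathrm{dom}(f)=\{x\mid \exists y\,(x,y)\in f\}$. An algebra of partial functions of the signature $\{-,\triangleright\}$ is a nonempty set of partial functions from some common set $X$ to some common set $Y$, closed under relative complement $f-g$ (set difference) and domain restriction $f\triangleright g=\{(x,y)\in g\mid x\in\mathrm{dom}(f)\}$. An abstract $\{-,\triangleright\}$-algebra (two binary operations) is representable if it is isomorphic to an algebra of partial functions. Put $a\cdot b:=a-(a-b)$; a representable algebra is partially ordered by $a\le b\iff a\cdot b=a$, with binary meet $\cdot$ and least element $0$. Elements $a,b$ are compatible if $a\triangleright b=b\triangleright a$. A representable algebra is compatibly complete if every subset of pairwise-compatible elements has a join. A subset $S$ of a poset is join dense if every element of the poset is the join of some subset of $S$. A compatible completion of a representable algebra $\mathfrak A$ is an embedding (injective homomorphism) $\iota\colon\mathfrak A\hookrightarrow\mathfrak C$ of $\{-,\triangleright\}$-algebras such that $\mathfrak C$ is representable and compatibly complete and $\iota[\mathfrak A]$ is join dense in $\mathfrak C$. *)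

(* Defs.v *)
From mathcomp Require Import all_boot.
From mathcomp Require Import boolp classical_sets functions.
Set Implicit Arguments.
Unset Strict Implicit.
Unset Printing Implicit Defensive.
Local Open Scope classical_set_scope.

Section PartialFunctions.
Variables X Y : Type.
Implicit Types f g : set (X * Y).

Definition is_partial_function f : Prop :=
  forall x y z, f (x, y) -> f (x, z) -> y = z.

Definition pf_dom f : set X := [set x | exists y, f (x, y)].

Definition pf_restrict f g : set (X * Y) :=
  [set p | g p /\ pf_dom f p.1].

(* The relative complement of partial functions is [f `\` g]. *)
Definition is_pf_algebra (F : set (set (X * Y))) : Prop :=
  [/\ F !=set0,
      (forall f, F f -> is_partial_function f),
      (forall f g, F f -> F g -> F (f `\` g)) &
      (forall f g, F f -> F g -> F (pf_restrict f g))].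

End PartialFunctions.

Record algebra := Algebra {
  carrier :> Type;
  diff : carrier -> carrier -> carrier;
  restrict : carrier -> carrier -> carrier }.

Arguments diff {_} _ _.
Arguments restrict {_} _ _.

Definition representable (A : algebra) : Prop :=
  exists (X Y : Type) (F : set (set (X * Y))) (h : A -> set (X * Y)),
    [/\ is_pf_algebra F,
        set_bij [set: A] F h,
        (forall a b, h (diff a b) = h a `\` h b) &
        (forall a b, h (restrict a b) = pf_restrict (h a) (h b))].

Definition homomorphism (A B : algebra) (h : A -> B) : Prop :=
  (forall a b, h (diff a b) = diff (h a) (h b)) /\
  (forall a b, h (restrict a b) = restrict (h a) (h b)).

Definition embedding (A B : algebra) (h : A -> B) : Prop :=
  homomorphism h /\ injective h.

Definition isomorphism (A B : algebra) (h : A -> B) : Prop :=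
  homomorphism h /\ bijective h.

Section Order.
Variable A : algebra.
Implicit Types (a b j : A) (S : set A).

Definition meet a b : A := diff a (diff a b).

Definition le a b : Prop := meet a b = a.

Definition is_join S j : Prop :=
  (forall a, S a -> le a j) /\
  (forall b, (forall a, S a -> le a b) -> le j b).

Definition compatible a b : Prop := restrict a b = restrict b a.

Definition pairwise_compatible S : Prop :=
  forall a b, S a -> S b -> compatible a b.

Definition join_dense S : Prop :=
  forall a, exists2 T : set A, T `<=` S & is_join T a.

End Order.

Definition compatibly_complete (A : algebra) : Prop :=
  forall S : set A, pairwise_compatible S -> exists j, is_join S j.

Definition compatible_completion (A C : algebra) (iota : A -> C) : Prop :=
  [/\ embedding iota, representable C, compatibly_complete C &
      join_dense (range iota)].

(* Main.v *)
From Pilot Require Import Defs.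
From mathcomp Require Import all_boot.
From mathcomp Require Import boolp classical_sets functions.
(* [restrict] is the operation of an algebra, not that of [functions]. *)
Import Pilot.Defs.

(** An element [c] of a compatible completion [iota : A -> C] is determined by
    its trace [lower iota c], the set of those [a] in [A] with [iota a] below
    [c]: by join density [c] is the join of the image of its trace.  So the
    theorem follows once the following two facts are established.

    - The operations of [C] act on traces by formulas that mention [A] only
      ([lower_diff], [lower_restrict]).  These rest on the existence of a
      nonzero element of the image of [A] below each nonzero element of [C]
      ([dense_nonzero]): disjointness and inclusion of domains in [C] can
      therefore be tested on elements of [A].
    - Any two compatible completions of [A] have the same traces
      ([lower_transfer]).  The trace of [c] is pairwise compatible, since [c] is
      a common upper bound; hence its image in the other completion has a join
      [c'], and the trace of [c'] is no larger because in a representable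
      algebra nothing nonzero below a join is disjoint from all the joinands
      ([join_disjoint]).

    Matching elements with equal traces is then a bijective homomorphism, and
    it commutes with the embeddings of [A].  Conversely an isomorphism that
    commutes with the embeddings preserves and reflects the order, so it
    preserves traces; this gives uniqueness. *)

Set Implicit Arguments.
Unset Strict Implicit.
Unset Printing Implicit Defensive.
Local Open Scope classical_set_scope.

(** * Computing in a representable algebra *)

(** Being the zero element, expressed by an equation between terms so that
    embeddings preserve and reflect it. *)
Definition null (A : algebra) (a : A) : Prop := diff a a = a.

Definition faithful (A : algebra) (X Y : Type) (h : A -> set (X * Y)) : Prop :=
  [/\ injective h,
      (forall a, is_partial_function (h a)),
      (forall a b, h (diff a b) = h a `\` h b) &
      (forall a b, h (restrict a b) = pf_restrict (h a) (h b))].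

Lemma representable_faithful (A : algebra) :
  representable A -> exists (X Y : Type) (h : A -> set (X * Y)), faithful h.
Proof.
move=> [X [Y [F [h [[_ Fpf _ _] [hF hinj _] hD hR]]]]].
exists X, Y, h; split=> // [a b hab|a].
  by apply: hinj => //; rewrite in_setE.
by apply: Fpf; apply: hF.
Qed.

Section Faithful.
Variables (A : algebra) (X Y : Type) (h : A -> set (X * Y)).
Hypothesis hf : faithful h.
Implicit Types a b : A.

Lemma faithful_meet a b : h (meet a b) = h a `&` h b.
Proof. by case: hf => _ _ hD _; rewrite /meet !hD setDD. Qed.

Lemma faithful_le a b : le a b <-> h a `<=` h b.
Proof.
case: (hf) => hinj _ _ _; split=> [ab|ab].
  by rewrite -ab faithful_meet; apply: subIsetr.
by apply: hinj; rewrite faithful_meet; apply/setIidPl.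
Qed.

Lemma faithful_null a : null a <-> h a = set0.
Proof.
case: (hf) => hinj _ hD _; split=> [a0|a0]; first by rewrite -a0 hD setDv.
by apply: hinj; rewrite hD setDv.
Qed.

End Faithful.

Section Representable.
Variable A : algebra.
Hypothesis repA : representable A.
Implicit Types (a b c d e j : A) (S : set A).

Lemma le_refl a : le a a.
Proof.
by have [X [Y [h hf]]] := representable_faithful repA; apply/(faithful_le hf).
Qed.

Lemma le_trans b a c : le a b -> le b c -> le a c.
Proof.
have [X [Y [h hf]]] := representable_faithful repA.
by rewrite !(faithful_le hf); apply: subset_trans.
Qed.

Lemma le_anti a b : le a b -> le b a -> a = b.
Proof.
have [X [Y [h hf]]] := representable_faithful repA.
rewrite !(faithful_le hf) => ab ba; case: hf => hinj _ _ _.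
by apply: hinj; apply/seteqP.
Qed.

Lemma is_join_uniq S a b : is_join S a -> is_join S b -> a = b.
Proof.
by move=> [Sa aS] [Sb bS]; apply: le_anti; [apply: aS | apply: bS].
Qed.

Lemma le_meet a b c : le a (meet b c) <-> le a b /\ le a c.
Proof.
have [X [Y [h hf]]] := representable_faithful repA.
by rewrite !(faithful_le hf) (faithful_meet hf) subsetI.
Qed.

Lemma meet_lel a b : le (meet a b) a.
Proof. by have /le_meet [] := le_refl (meet a b). Qed.

Lemma meet_ler a b : le (meet a b) b.
Proof. by have /le_meet [] := le_refl (meet a b). Qed.

Lemma null_le a b : null b -> le a b -> null a.
Proof.
have [X [Y [h hf]]] := representable_faithful repA.
by rewrite !(faithful_null hf) (faithful_le hf) => ->; rewrite subset0.
Qed.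

Lemma le_diff a b c : le a (diff b c) <-> le a b /\ null (meet a c).
Proof.
have [X [Y [h hf]]] := representable_faithful repA.
rewrite !(faithful_le hf) (faithful_null hf) (faithful_meet hf).
case: hf => _ _ -> _; rewrite setDE subsetI; split=> -[ab ac]; split=> //.
  by apply/disjoints_subset.
by apply/disjoints_subset.
Qed.

Lemma null_diff a b : null (diff a b) <-> le a b.
Proof.
have [X [Y [h hf]]] := representable_faithful repA.
rewrite (faithful_le hf) (faithful_null hf).
by case: hf => _ _ -> _; rewrite setD_eq0.
Qed.

(** Two restrictions of one partial function agree wherever both are
    defined. *)
Lemma le_compatible a b c : le a c -> le b c -> compatible a b.
Proof.
have [X [Y [h hf]]] := representable_faithful repA.
rewrite !(faithful_le hf) => ac bc; case: hf => hinj hpf _ hR.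
apply: hinj; rewrite !hR; apply/seteqP; split=> -[x y] [/= h1 [z h2]].
  split; last by exists y.
  by rewrite (hpf c x y z) //; [exact: bc | exact: ac].
split; last by exists y.
by rewrite (hpf c x y z) //; [exact: ac | exact: bc].
Qed.

(** If [d] were nonzero and disjoint from [S], then [diff j d] would be a
    strictly smaller upper bound of [S] than its join [j]. *)
Lemma join_disjoint S j d : is_join S j -> le d j ->
  (forall s, S s -> null (meet d s)) -> null d.
Proof.
move=> [Sj jS] dj dS.
have /jS : forall s, S s -> le s (diff j d).
  move=> s Ss; apply/le_diff; split; first exact: Sj.
  apply: (null_le (dS _ Ss)); apply/le_meet.
  by split; [apply: meet_ler | apply: meet_lel].
move=> /(le_trans dj) /le_diff [_].
by move/null_le; apply; apply/le_meet; split; apply: le_refl.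
Qed.

(** Statements about domains are expressed by equations between terms:
    [le a (restrict c a)] means that the domain of [a] is included in that of
    [c], and [null (restrict c a)] that the two domains are disjoint. *)
Lemma le_restrict a c d :
  le a (restrict c d) <-> le a d /\ le a (restrict c a).
Proof.
have [X [Y [h hf]]] := representable_faithful repA.
rewrite !(faithful_le hf); case: hf => _ _ _ hR; rewrite !hR.
split=> [acd|[ad aca]].
  by split=> p /[dup] ap /acd [].
by move=> p /[dup] /ad dp /aca [].
Qed.

Lemma null_restrict_diff a c e :
  le e (diff a (restrict c a)) -> null (restrict c e).
Proof.
have [X [Y [h hf]]] := representable_faithful repA.
rewrite (faithful_le hf) (faithful_null hf); case: hf => _ _ hD hR.
rewrite hD !hR => ea; apply/seteqP; split=> // p [/ea [ap nap] cp].
by apply: nap.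
Qed.

Lemma null_restrict_le c f e :
  le f c -> null (restrict c e) -> null (restrict f e).
Proof.
have [X [Y [h hf]]] := representable_faithful repA.
rewrite (faithful_le hf) !(faithful_null hf); case: hf => _ _ _ hR.
rewrite !hR -!subset0 => fc ce0 p [ep [y fy]]; apply: (ce0 p).
by split=> //; exists y; apply: fc.
Qed.

(** A nonzero part of [restrict e c] has its domain inside that of [e], so
    the two domains meet. *)
Lemma nonnull_restrict e f c :
  le f (restrict e c) -> ~ null f -> ~ null (restrict f e).
Proof.
have [X [Y [h hf]]] := representable_faithful repA.
rewrite (faithful_le hf) !(faithful_null hf); case: hf => _ _ _ hR.
rewrite !hR => fec f0 fe0; apply: f0; apply/seteqP; split=> // -[x y] fxy.
have [_ [z /= exz]] := fec _ fxy.
suff : set0 (x, z) by [].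
by rewrite -fe0; split=> //; exists y.
Qed.

Lemma nonnull_restrict_dom e c :
  le e (restrict c e) -> ~ null e -> ~ null (restrict e c).
Proof.
have [X [Y [h hf]]] := representable_faithful repA.
rewrite (faithful_le hf) !(faithful_null hf); case: hf => _ _ _ hR.
rewrite !hR => ece e0 ec0; apply: e0; apply/seteqP; split=> // -[x y] exy.
have [_ [z /= cxz]] := ece _ exy.
suff : set0 (x, z) by [].
by rewrite -ec0; split=> //; exists y.
Qed.

End Representable.

(** * Traces of elements on a join-dense subalgebra *)

Definition lower (A C : algebra) (iota : A -> C) (c : C) : set A :=
  [set a | le (iota a) c].

Section Homomorphism.
Variables (A C : algebra) (iota : A -> C).

Lemma homomorphism_meet a b :
  homomorphism iota -> iota (meet a b) = meet (iota a) (iota b).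
Proof. by move=> [iD _]; rewrite /meet !iD. Qed.

Hypothesis emb : embedding iota.

Lemma embedding_le a b : le (iota a) (iota b) <-> le a b.
Proof.
case: emb => hom inj; rewrite /le -homomorphism_meet //.
by split=> [/inj|->].
Qed.

Lemma embedding_null a : null (iota a) <-> null a.
Proof. by case: emb => -[iD _] inj; rewrite /null -iD; split=> [/inj|->]. Qed.

Lemma embedding_compatible a b :
  compatible (iota a) (iota b) <-> compatible a b.
Proof.
by case: emb => -[_ iR] inj; rewrite /compatible -!iR; split=> [/inj|->].
Qed.

End Homomorphism.

Section Dense.
Variables (A C : algebra) (iota : A -> C).
Hypotheses (emb : embedding iota) (repC : representable C).
Hypothesis dense : join_dense (range iota).
Implicit Types (a e f : A) (c d : C).

(** If everything of [A] below [c] were zero, the join that density provides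
    for [c] would be a join of zeros. *)
Lemma dense_nonzero c : ~ null c -> exists2 e, ~ null e & le (iota e) c.
Proof.
move=> c0; apply: contrapT => none; apply: c0.
have [T Tiota Tc] := dense c; apply: (join_disjoint repC Tc).
  exact: le_refl.
move=> t Tt; have [a _ at_] := Tiota _ Tt; case: Tc => /(_ _ Tt) tc _.
apply: (null_le repC) (_ : null t) _.
  rewrite -at_ embedding_null //; apply: contrapT => a0.
  by apply: none; exists a => //; rewrite at_.
exact: meet_ler.
Qed.

Lemma lower_join c : is_join (iota @` lower iota c) c.
Proof.
have [T Tiota [Tc cT]] := dense c.
split=> [_ [a ac <-] //|b bub]; apply: cT => t Tt.
have [a _ at_] := Tiota _ Tt; apply: bub; exists a => //.
by rewrite /lower /= at_; apply: Tc.
Qed.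

Lemma lower_inj : injective (lower iota).
Proof.
move=> c d cd; apply: (is_join_uniq repC (lower_join c)).
by rewrite cd; apply: lower_join.
Qed.

(** Being disjoint from [d] is tested on the elements of [A], since a nonzero
    [meet (iota a) d] has a nonzero element of [A] below it. *)
Lemma lower_diff c d :
  lower iota (diff c d) =
  [set a | lower iota c a /\ forall e, le e a -> lower iota d e -> null e].
Proof.
apply/seteqP; split=> a; rewrite /lower /=.
  move=> /(le_diff repC) [ac ad]; split=> // e ea ed.
  apply/(embedding_null emb)/(null_le repC ad)/(le_meet repC); split=> //.
  by apply/(embedding_le emb).
move=> [ac ad]; apply/(le_diff repC); split=> //; apply: contrapT => n0.
have [e e0 /(le_meet repC) [/(embedding_le emb) ea ed]] := dense_nonzero n0.
exact/e0/ad.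
Qed.

(** The second conjunct says that the domain of [iota a] is included in that
    of [c]: whatever is left of [a] outside the domain of [c], if nonzero,
    has a nonzero element [e] of [A] below it. *)
Lemma lower_restrict c d :
  lower iota (restrict c d) =
  [set a | lower iota d a /\ forall e, le e a -> ~ null e ->
             exists2 f, lower iota c f & ~ null (restrict f e)].
Proof.
apply/seteqP; split=> a; rewrite /lower /=.
  move=> /[dup] acd /(le_restrict repC) [ad _]; split=> // e ea e0.
  have iea : le (iota e) (iota a) by apply/(embedding_le emb).
  have /(le_restrict repC) [_ ece] := le_trans repC iea acd.
  have e0' : ~ null (iota e) by rewrite embedding_null.
  have [f f0 fec] := dense_nonzero (nonnull_restrict_dom repC ece e0').
  exists f; first by have /(le_restrict repC) [] := fec.
  rewrite -(embedding_null emb); case: (emb) => -[_ ->] _.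
  by apply: (nonnull_restrict repC fec); rewrite embedding_null.
move=> [ad adom]; apply/(le_restrict repC); split=> //.
apply/(null_diff repC); apply: contrapT => n0.
have [e e0 /[dup] ea /(le_diff repC) [/(embedding_le emb) ea' _]] :=
  dense_nonzero n0.
have [f fc fe0] := adom e ea' e0; apply: fe0.
rewrite -(embedding_null emb); case: (emb) => -[_ ->] _.
exact: (null_restrict_le repC fc (null_restrict_diff repC ea)).
Qed.

End Dense.

(** * Comparing two completions *)

(** The partner of [c] is the join in [C'] of the image of the trace of [c];
    what needs proof is that this join has nothing more of [A] below it. *)
Lemma lower_transfer (A C C' : algebra) (iota : A -> C) (iota' : A -> C') :
  compatible_completion iota -> compatible_completion iota' ->
  forall c, exists c', lower iota c = lower iota' c'.
Proof.
move=> [emb repC _ dense] [emb' repC' compl' _] c.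
have [|c' c'join] := compl' (iota' @` lower iota c).
  move=> _ _ [a ac <-] [b bc <-].
  apply/(embedding_compatible emb')/(embedding_compatible emb).
  exact: (le_compatible repC ac bc).
exists c'; apply/seteqP; split=> b; rewrite /lower /=.
  by move=> bc; case: c'join => ub _; apply: ub; exists b.
move=> bc'; apply/(null_diff repC); apply: contrapT => n0.
(* A nonzero [e] below [b] and disjoint from [c] would lie below the join
   [c'] while being disjoint from every joinand. *)
have [e e0 /(le_diff repC) [/(embedding_le emb) eb ec]] :=
  dense_nonzero emb repC dense n0.
apply: e0; rewrite -(embedding_null emb').
apply: (join_disjoint repC' c'join).
  by apply: (le_trans repC') bc'; apply/(embedding_le emb').
move=> _ [a ac <-].
rewrite -homomorphism_meet ?(embedding_null emb'); last by case: emb'.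
rewrite -(embedding_null emb) homomorphism_meet; last by case: emb.
apply: (null_le repC ec).
apply/(le_meet repC); split; first exact: meet_lel.
by apply: (le_trans repC) ac; apply: meet_ler.
Qed.

Lemma lower_isomorphism (A C C' : algebra) (iota : A -> C) (theta : C -> C') :
  isomorphism theta -> lower (theta \o iota) \o theta = lower iota.
Proof.
move=> [hom /bij_inj inj]; apply/funext => c; apply/seteqP.
by split=> a; rewrite /lower /= (embedding_le (conj hom inj)).
Qed.

Theorem proposition4p11 (A C C' : algebra) (iota : A -> C) (iota' : A -> C')
    (repA : representable A)
    (complC : compatible_completion iota)
    (complC' : compatible_completion iota') :
  exists! theta : C -> C', isomorphism theta /\ theta \o iota = iota'.
Proof.
have [theta thetaE] := choice (lower_transfer complC complC').
have [theta' theta'E] := choice (lower_transfer complC' complC).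
case: complC complC' => emb repC _ dense [emb' repC' _ dense'].
have inj := lower_inj repC dense; have inj' := lower_inj repC' dense'.
exists theta; split; last first.
  move=> tau [tau_iso tau_iota]; apply/funext => c; apply: inj'.
  by rewrite -thetaE -(lower_isomorphism iota tau_iso) tau_iota.
split.
  split; first split=> c d.
  - by apply: inj'; rewrite -thetaE !lower_diff // !thetaE.
  - by apply: inj'; rewrite -thetaE !lower_restrict // !thetaE.
  - exists theta' => c; first by apply: inj; rewrite -theta'E -thetaE.
    by apply: inj'; rewrite -thetaE -theta'E.
apply/funext => a; apply: inj'; rewrite -thetaE.
apply/seteqP; split=> b; rewrite /lower /=.
  by move=> /(embedding_le emb); rewrite (embedding_le emb').
by move=> /(embedding_le emb'); rewrite (embedding_le emb).
Qed.
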